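(* Let $\mathbf{P}$ be a small category whose set of objects $P$ carries a $\sigma$-algebra and a measure $\mu$, let $\mathbf{A}$ be an abelian category, and let $w$ be an exact weight on $\mathbf{A}$. Let $M,N:\mathbf{P}\to\mathbf{A}$ be functors such that $w(M)$ and $w(N)$ are $\mu$-integrable. Then $$\int_P |w(M)-w(N)|\,d\mu \;\le\; d_W(M,N)\;\le\;\int_P \big(w(M)+w(N)\big)\,d\mu .$$
   Context: A weight on an abelian category $\mathbf{A}$ assigns to each object $A$ a value $w(A)\in[0,\infty]$ with $w(0)=0$ and $w(A)=w(B)$ whenever $A\cong B$. It is exact if for each short exact sequence $0\to A\to B\to C\to 0$ one has $w(A)\le w(B)+w(C)$, $w(B)\le w(A)+w(C)$ and $w(C)\le w(A)+w(B)$. A persistence module is a functor $M:\mathbf{P}\to\mathbf{A}$; morphisms are natural transformations; these form an abelian category $\mathbf{A}^{\mathbf{P}}$. For a persistence module $M$, $w(M)$ denotes the function $P\to[0,\infty]$, $p\mapsto w(M(p))$. ''$\mu$-integrable'' means measurable with finite integral. (Hence $w(M),w(N)$ are finite almost everywhere; at points where both are infinite, $|w(M)-w(N)|$ may be read as $0$.) Let $\mathcal{T}$ be the class of persistence modules $M$ such that $w(M)$ is $\mu$-integrable, with weight $W(M)=(\mu\circ w)(M)=\int_P w(M)\,d\mu$. The path metric $d_W=d_{\mu\circ w}$ is: $d_W(M,N)$ is the infimum, over all finite zigzags of morphisms of persistence modules joining $M=M_0,M_1,\dots,M_n=N$ ($n\ge0$, each $f_i$ a morphism between $M_{i-1}$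 and $M_i$ in either direction) such that each $\ker f_i$ and $\operatorname{coker} f_i$ lies in $\mathcal{T}$, of the cost $\sum_{i=1}^n\big(W(\ker f_i)+W(\operatorname{coker} f_i)\big)$ (with $d_W(M,N)=\infty$ if there are no such zigzags). *)

(* Defs.v *)
From HB Require Import structures.
From mathcomp Require Import all_boot all_order all_algebra.
From mathcomp Require Import all_classical all_reals all_analysis.

Set Implicit Arguments.
Unset Strict Implicit.
Unset Printing Implicit Defensive.

Import Order.TTheory GRing.Theory Num.Theory.
Local Open Scope classical_set_scope.
Local Open Scope ring_scope.

Record category (ob : Type) := Category {
  mor : ob -> ob -> Type;
  mid : forall x, mor x x;
  mcomp : forall x y z, mor y z -> mor x y -> mor x z;
  comp1m : forall x y (f : mor x y), mcomp (mid y) f = f;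
  compm1 : forall x y (f : mor x y), mcomp f (mid x) = f;
  compmA : forall x y z t (h : mor z t) (g : mor y z) (f : mor x y),
    mcomp h (mcomp g f) = mcomp (mcomp h g) f
}.

Arguments mid {ob} c x.
Arguments mcomp {ob c x y z} g f.

(** Categories enriched in abelian groups.  The [zmodType] structure on the
    hom-types includes a choice operator, which every type has by
    [gen_choiceMixin]. *)
Record preadditive (ob : Type) := Preadditive {
  zmor : ob -> ob -> zmodType;
  zmid : forall x, zmor x x;
  zcomp : forall x y z, zmor y z -> zmor x y -> zmor x z;
  zcomp1m : forall x y (f : zmor x y), zcomp (zmid y) f = f;
  zcompm1 : forall x y (f : zmor x y), zcomp f (zmid x) = f;
  zcompmA : forall x y z t (h : zmor z t) (g : zmor y z) (f : zmor x y),
    zcomp h (zcomp g f) = zcomp (zcomp h g) f;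
  zcompDl : forall x y z (g g' : zmor y z) (f : zmor x y),
    zcomp (g + g') f = zcomp g f + zcomp g' f;
  zcompDr : forall x y z (g : zmor y z) (f f' : zmor x y),
    zcomp g (f + f') = zcomp g f + zcomp g f'
}.

Definition preadditive_category ob (A : preadditive ob) : category ob :=
  Category (@zcomp1m _ A) (@zcompm1 _ A) (@zcompmA _ A).
Coercion preadditive_category : preadditive >-> category.

HB.instance Definition _ ob (A : preadditive ob) (x y : ob) :=
  GRing.Zmodule.on (mor A x y).

Definition isomorphic ob (C : category ob) (x y : ob) : Prop :=
  exists (f : mor C x y) (g : mor C y x),
    mcomp g f = mid C x /\ mcomp f g = mid C y.

Definition mono ob (C : category ob) x y (f : mor C x y) : Prop :=
  forall t (g h : mor C t x), mcomp f g = mcomp f h -> g = h.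

Definition epi ob (C : category ob) x y (f : mor C x y) : Prop :=
  forall t (g h : mor C y t), mcomp g f = mcomp h f -> g = h.

Definition zero_object ob (C : category ob) (z : ob) : Prop :=
  forall x, (exists! f : mor C z x, True) /\ (exists! f : mor C x z, True).

Definition is_kernel ob (A : preadditive ob) x y (f : mor A x y)
    k (i : mor A k x) : Prop :=
  mcomp f i = 0 /\
  forall t (g : mor A t x), mcomp f g = 0 ->
    exists! h : mor A t k, mcomp i h = g.

Definition is_cokernel ob (A : preadditive ob) x y (f : mor A x y)
    c (q : mor A y c) : Prop :=
  mcomp q f = 0 /\
  forall t (g : mor A y t), mcomp g f = 0 ->
    exists! h : mor A c t, mcomp h q = g.

(** The remaining identities [mcomp p2 i1 = 0] and [mcomp p1 i2 = 0] follow from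
    these three. *)
Definition is_biproduct ob (A : preadditive ob) x y b
    (i1 : mor A x b) (i2 : mor A y b)
    (p1 : mor A b x) (p2 : mor A b y) : Prop :=
  [/\ mcomp p1 i1 = mid A x, mcomp p2 i2 = mid A y &
      mcomp i1 p1 + mcomp i2 p2 = mid A b].

Record abelian_category ob (A : preadditive ob) : Prop := Abelian {
  has_zero_object : exists z, zero_object A z;
  has_biproducts : forall x y, exists b (i1 : mor A x b) (i2 : mor A y b)
    (p1 : mor A b x) (p2 : mor A b y), is_biproduct i1 i2 p1 p2;
  has_kernels : forall x y (f : mor A x y),
    exists k (i : mor A k x), is_kernel f i;
  has_cokernels : forall x y (f : mor A x y),
    exists c (q : mor A y c), is_cokernel f q;
  mono_normal : forall x y (f : mor A x y), mono f ->
    exists z (g : mor A y z), is_kernel g f;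
  epi_normal : forall x y (f : mor A x y), epi f ->
    exists z (g : mor A z x), is_cokernel g f
}.

(** Exactness of 0 -> x -f-> y -g-> z -> 0: [f] is a kernel of [g] (hence mono,
    with im f = ker g) and [g] is a cokernel of [f] (hence epi). *)
Definition short_exact ob (A : preadditive ob) x y z
    (f : mor A x y) (g : mor A y z) : Prop :=
  is_kernel g f /\ is_cokernel f g.

Record functor obP obA (P : category obP) (A : category obA) := Functor {
  fobj :> obP -> obA;
  fmor : forall p q, mor P p q -> mor A (fobj p) (fobj q);
  fmor_id : forall p, fmor (mid P p) = mid A (fobj p);
  fmor_comp : forall p q r (v : mor P q r) (u : mor P p q),
    fmor (mcomp v u) = mcomp (fmor v) (fmor u)
}.

Record nat_trans obP obA (P : category obP) (A : category obA)
    (M N : functor P A) := NatTrans {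
  component :> forall p, mor A (M p) (N p);
  naturality : forall p q (u : mor P p q),
    mcomp (component q) (fmor M u) = mcomp (fmor N u) (component p)
}.

Lemma nat_trans_ext obP obA (P : category obP) (A : category obA)
    (M N : functor P A) (f g : nat_trans M N) :
  (forall p, f p = g p) -> f = g.
Proof.
case: f g => [f nf] [g ng] /= fg.
have e : f = g by apply: functional_extensionality_dep.
by case: _ / e in ng fg *; congr NatTrans; exact: Prop_irrelevance.
Qed.

Section FunctorCategory.
Context (obP obA : Type) (P : category obP).

Definition nat_id (A : category obA) (M : functor P A) : nat_trans M M.
Proof.
by exists (fun p => mid A (M p)) => p q u; rewrite comp1m compm1.
Defined.

Definition nat_comp (A : category obA) (L M N : functor P A)
  (g : nat_trans M N) (f : nat_trans L M) : nat_trans L N.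
Proof.
exists (fun p => mcomp (g p) (f p)) => p q u.
by rewrite -compmA naturality !compmA naturality.
Defined.

Context (A : preadditive obA).
Implicit Types M N : functor P A.

Lemma compDl x y z (g g' : mor A y z) (f : mor A x y) :
  mcomp (g + g') f = mcomp g f + mcomp g' f.
Proof. exact: zcompDl. Qed.

Lemma compDr x y z (g : mor A y z) (f f' : mor A x y) :
  mcomp g (f + f') = mcomp g f + mcomp g f'.
Proof. exact: zcompDr. Qed.

Lemma comp0m x y z (f : mor A x y) : mcomp (0 : mor A y z) f = 0.
Proof. by apply: (addrI (mcomp 0 f)); rewrite -compDl !addr0. Qed.

Lemma compm0 x y z (g : mor A y z) : mcomp g (0 : mor A x y) = 0.
Proof. by apply: (addrI (mcomp g 0)); rewrite -compDr !addr0. Qed.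

Lemma compNm x y z (g : mor A y z) (f : mor A x y) :
  mcomp (- g) f = - mcomp g f.
Proof. by apply/eqP; rewrite -addr_eq0 -compDl addNr comp0m. Qed.

Lemma compmN x y z (g : mor A y z) (f : mor A x y) :
  mcomp g (- f) = - mcomp g f.
Proof. by apply/eqP; rewrite -addr_eq0 -compDr addNr compm0. Qed.

Definition nat_zero M N : nat_trans M N.
Proof. by exists (fun p => 0) => p q u; rewrite comp0m compm0. Defined.

Definition nat_add M N (f g : nat_trans M N) : nat_trans M N.
Proof.
by exists (fun p => f p + g p) => p q u; rewrite compDl compDr !naturality.
Defined.

Definition nat_opp M N (f : nat_trans M N) : nat_trans M N.
Proof.
by exists (fun p => - f p) => p q u; rewrite compNm compmN naturality.
Defined.

Lemma nat_addA M N : associative (@nat_add M N).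
Proof. by move=> f g h; apply: nat_trans_ext => p /=; rewrite addrA. Qed.
Lemma nat_addC M N : commutative (@nat_add M N).
Proof. by move=> f g; apply: nat_trans_ext => p /=; rewrite addrC. Qed.
Lemma nat_add0 M N : left_id (nat_zero M N) (@nat_add M N).
Proof. by move=> f; apply: nat_trans_ext => p /=; rewrite add0r. Qed.
Lemma nat_addN M N : left_inverse (nat_zero M N) (@nat_opp M N) (@nat_add M N).
Proof. by move=> f; apply: nat_trans_ext => p /=; rewrite addNr. Qed.

HB.instance Definition _ M N := gen_eqMixin (nat_trans M N).
HB.instance Definition _ M N := gen_choiceMixin (nat_trans M N).
HB.instance Definition _ M N := GRing.isZmodule.Build (nat_trans M N)
  (@nat_addA M N) (@nat_addC M N) (@nat_add0 M N) (@nat_addN M N).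

Definition functor_category : preadditive (functor P A).
Proof.
refine (@Preadditive (functor P A) (fun M N => nat_trans M N : zmodType)
  (@nat_id A) (@nat_comp A) _ _ _ _ _) => *; apply: nat_trans_ext => p /=.
- exact: zcomp1m.
- exact: zcompm1.
- exact: zcompmA.
- exact: zcompDl.
- exact: zcompDr.
Defined.

End FunctorCategory.

Section Weights.
Context (R : realType).
Local Open Scope ereal_scope.

(** [w] takes values in [[0, +oo]]; the value on a zero object does not depend
    on the choice of the latter. *)
Record weight ob (A : preadditive ob) (w : ob -> \bar R) : Prop := Weight {
  weight_ge0 : forall x, 0 <= w x;
  weight_zero : forall z, zero_object A z -> w z = 0;
  weight_iso : forall x y, isomorphic A x y -> w x = w y
}.

Record exact_weight ob (A : preadditive ob) (w : ob -> \bar R) : Prop :=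
  ExactWeight {
  exact_weight_weight : weight A w;
  exact_weight_le : forall x y z (f : mor A x y) (g : mor A y z),
    short_exact f g ->
    [/\ w x <= w y + w z, w y <= w x + w z & w z <= w x + w y]
}.

(** A morphism x -> y whose kernel and cokernel are in [T], of cost [c].  Kernel
    and cokernel are unique up to isomorphism, so any representative may be
    used as soon as [T] and [W] are invariant under isomorphism. *)
Definition step ob (A : preadditive ob) (T : set ob) (W : ob -> \bar R)
    (x y : ob) (c : \bar R) : Prop :=
  exists (f : mor A x y) k (i : mor A k x) l (q : mor A y l),
    [/\ is_kernel f i, is_cokernel f q, T k, T l & c = W k + W l].

Inductive zigzag ob (A : preadditive ob) (T : set ob) (W : ob -> \bar R)
    (x : ob) : ob -> \bar R -> Prop :=
| zigzag_nil : zigzag A T W x x 0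
| zigzag_forward y z c c' : zigzag A T W x y c ->
    step A T W y z c' -> zigzag A T W x z (c + c')
| zigzag_backward y z c c' : zigzag A T W x y c ->
    step A T W z y c' -> zigzag A T W x z (c + c').

(** [ereal_inf set0 = +oo]: the distance is infinite without any zigzag. *)
Definition path_metric ob (A : preadditive ob) (T : set ob) (W : ob -> \bar R)
    (x y : ob) : \bar R :=
  ereal_inf [set c | zigzag A T W x y c].

Context (d : measure_display) (P : measurableType d).
Context (mu : {measure set P -> \bar R}) (CP : category P).
Context (obA : Type) (A : preadditive obA) (w : obA -> \bar R).

Definition integrable_module : set (functor CP A) :=
  [set M | mu.-integrable setT (fun p => w (M p))].

Definition integral_weight (M : functor CP A) : \bar R :=
  \int[mu]_p w (M p).

Definition d_W : functor CP A -> functor CP A -> \bar R :=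
  path_metric (functor_category CP A) integrable_module integral_weight.

End Weights.

(* Main.v *)
(** At each object, a step f : X -> Y splits into the short exact sequences
    0 -> ker f -> X -> im f -> 0 and 0 -> im f -> Y -> coker f -> 0, so exactness
    bounds [w X] by [w Y + w (ker f) + w (coker f)] and conversely.  The
    intermediate modules of a zigzag need not have measurable weight; hence these
    bounds are added up pointwise, and only the total of the kernels and
    cokernels is integrated.  The upper bound comes from the zigzag
    M -> 0 <- N. *)
Require Import Defs.
From mathcomp Require Import all_boot all_order all_algebra.
From mathcomp Require Import all_classical all_reals all_analysis.

Import Order.TTheory GRing.Theory Num.Theory.
Local Open Scope classical_set_scope.
Local Open Scope ring_scope.

(** * Universal properties of kernels and cokernels *)

Section Preadditive.
Context {ob : Type} {A : preadditive ob}.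

Lemma kernel_mono {x y : ob} {f : mor A x y} {k} {i : mor A k x} :
  is_kernel f i -> mono i.
Proof.
move=> [fi0 univ] t g h gh.
have [|u [_ uniq_u]] := univ t (mcomp i g); first by rewrite compmA fi0 comp0m.
by rewrite -(uniq_u g) // -(uniq_u h).
Qed.

Lemma cokernel_epi {x y : ob} {f : mor A x y} {c} {q : mor A y c} :
  is_cokernel f q -> epi q.
Proof.
move=> [qf0 univ] t g h gh.
have [|u [_ uniq_u]] := univ t (mcomp g q); first by rewrite -compmA qf0 compm0.
by rewrite -(uniq_u g) // -(uniq_u h).
Qed.

Lemma kernel_lift {x y : ob} {f : mor A x y} {k} {i : mor A k x} :
  is_kernel f i -> forall t (g : mor A t x), mcomp f g = 0 ->
  exists h, mcomp i h = g.
Proof. by move=> [_ univ] t g /univ[h [? _]]; exists h. Qed.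

Lemma cokernel_desc {x y : ob} {f : mor A x y} {c} {q : mor A y c} :
  is_cokernel f q -> forall t (g : mor A y t), mcomp g f = 0 ->
  exists h, mcomp h q = g.
Proof. by move=> [_ univ] t g /univ[h [? _]]; exists h. Qed.

Lemma is_kernel_of_mono {x y : ob} {f : mor A x y} {k} {i : mor A k x} :
  mono i -> mcomp f i = 0 ->
  (forall t (g : mor A t x), mcomp f g = 0 -> exists h, mcomp i h = g) ->
  is_kernel f i.
Proof.
move=> mi fi0 lift; split=> // t g /lift[h ih].
by exists h; split=> // h' ih'; apply: mi; rewrite ih ih'.
Qed.

Lemma is_cokernel_of_epi {x y : ob} {f : mor A x y} {c} {q : mor A y c} :
  epi q -> mcomp q f = 0 ->
  (forall t (g : mor A y t), mcomp g f = 0 -> exists h, mcomp h q = g) ->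
  is_cokernel f q.
Proof.
move=> eq qf0 desc; split=> // t g /desc[h hq].
by exists h; split=> // h' hq'; apply: eq; rewrite hq hq'.
Qed.

(** As [g] kills [m], it factors through [q]; so whatever [q] kills is also killed by [g] and lifts
    along [m]. *)
Lemma kernel_of_cokernel {x y z : ob} {m : mor A x y} {g : mor A y z}
    {c} {q : mor A y c} :
  is_kernel g m -> is_cokernel m q -> is_kernel q m.
Proof.
move=> km cq; apply: (is_kernel_of_mono (kernel_mono km) cq.1) => t h qh0.
apply: (kernel_lift km _); have [r <-] := cokernel_desc cq _ _ km.1.
by rewrite -compmA qh0 compm0.
Qed.

(** Cancelling [e] shows that [m] and [mcomp m e] are annihilated by the same morphisms. *)
Lemma cokernel_epi_comp {x y z : ob} {e : mor A x y} {m : mor A y z}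
    {c} {q : mor A z c} :
  epi e -> is_cokernel (mcomp m e) q -> is_cokernel m q.
Proof.
move=> ee cq; apply: (is_cokernel_of_epi (cokernel_epi cq)).
  by apply: ee; rewrite comp0m -compmA cq.1.
by move=> t g gm0; apply: (cokernel_desc cq _); rewrite compmA gm0 comp0m.
Qed.

End Preadditive.

(** * Image factorization in an abelian category, and the weight bound for one morphism *)

Section Abelian.
Context {ob : Type} {A : preadditive ob} (hA : abelian_category A).

Lemma coimage_mono {x y k c : ob} {f : mor A x y} {i : mor A k x}
    {e : mor A x c} {m : mor A c y} :
  is_kernel f i -> is_cokernel i e -> mcomp m e = f -> mono m.
Proof.
move=> ki ce mef.
(* If [m a = 0] then the cokernel [r] of [a] is split mono: [mcomp r e] is the
   cokernel of some [b], [f] kills [b], hence so does [e], which therefore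
   factors through [mcomp r e]. *)
have m_eq0 t (a : mor A t c) : mcomp m a = 0 -> a = 0.
  move=> ma0; have [l [r cr]] := has_cokernels hA a.
  have [m' m'r] := cokernel_desc cr _ _ ma0.
  have ere : epi (mcomp r e).
    move=> s g h; rewrite !compmA => /(cokernel_epi ce).
    exact: (cokernel_epi cr).
  have [z [b cb]] := epi_normal hA ere.
  have [|b' ib'] := kernel_lift ki _ b.
    by rewrite -mef -m'r -!compmA (compmA r) cb.1 compm0.
  have [|s sre] := cokernel_desc cb _ e; first by rewrite -ib' compmA ce.1 comp0m.
  have sr1 : mcomp s r = mid A c.
    by apply: (cokernel_epi ce); rewrite -compmA sre comp1m.
  by rewrite -[a](comp1m (c := A)) -sr1 -compmA cr.1 compm0.
move=> t g h mgh; apply/eqP; rewrite -subr_eq0; apply/eqP/m_eq0.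
by rewrite compDr compmN mgh subrr.
Qed.

(** The coimage, the cokernel [e] of [i], serves as the image. The induced [m] is mono, hence
    normal, hence the kernel of its own cokernel; and that cokernel is [q], because [e] is epi. *)
Lemma image_short_exact {x y k l : ob} {f : mor A x y} {i : mor A k x}
    {q : mor A y l} :
  is_kernel f i -> is_cokernel f q ->
  exists c (e : mor A x c) (m : mor A c y), short_exact i e /\ short_exact m q.
Proof.
move=> ki cq; have [c [e ce]] := has_cokernels hA i.
have [m mef] := cokernel_desc ce _ _ ki.1.
have [z [g kg]] := mono_normal hA (coimage_mono ki ce mef).
have cqm : is_cokernel m q.
  by apply: (cokernel_epi_comp (cokernel_epi ce)); rewrite mef.
exists c, e, m; split; split=> //; first exact: kernel_of_cokernel ki ce.
exact: kernel_of_cokernel kg cqm.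
Qed.

Lemma exact_weight_step {R : realType} {w : ob -> \bar R} (hw : exact_weight A w)
    {x y k l : ob} {f : mor A x y} {i : mor A k x} {q : mor A y l} :
  is_kernel f i -> is_cokernel f q ->
  (w x <= w y + (w k + w l) /\ w y <= w x + (w k + w l))%E.
Proof.
move=> ki cq; have [c [e [m [se1 se2]]]] := image_short_exact ki cq.
have [_ xkc ckx] := exact_weight_le hw se1.
have [cyl ycl _] := exact_weight_le hw se2.
split.
  by apply: (le_trans xkc); rewrite addeCA leeD2l.
by apply: (le_trans ycl); rewrite addeA leeD2r // (le_trans ckx) // addeC.
Qed.

End Abelian.

(** * Kernels and cokernels of natural transformations, computed objectwise *)

Section FunctorCategory.
Context {obP obA : Type} {CP : category obP} {A : preadditive obA}.
Implicit Types M N K : functor CP A.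


(** Choice picks a kernel at each object. Naturality of [f] lets [fmor M u] restrict to these, and
    the functor laws follow by cancelling the monos [i p]. *)
Lemma exists_kernel_functor {M N} (f : nat_trans M N) :
  abelian_category A ->
  exists K (i : nat_trans K M), forall p, is_kernel (f p) (i p).
Proof.
move=> hA.
have kp p : {k : obA & {i : mor A k (M p) | is_kernel (f p) i}}.
  by case: (cid (has_kernels hA (f p))) => k /cid[i ki]; exists k, i.
pose i p := sval (projT2 (kp p)).
have ki p : is_kernel (f p) (i p) := proj2_sig (projT2 (kp p)).
have lift p q (u : mor CP p q) :
    {h | mcomp (i q) h = mcomp (fmor M u) (i p)}.
  apply/cid/(kernel_lift (ki q)).
  by rewrite compmA naturality -compmA (ki p).1 compm0.
have id_lift p : sval (lift p p (mid CP p)) = mid A _.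
  apply: (kernel_mono (ki p)); rewrite (proj2_sig (lift _ _ _)).
  by rewrite fmor_id comp1m compm1.
have comp_lift p q r (v : mor CP q r) (u : mor CP p q) :
    sval (lift p r (mcomp v u)) = mcomp (sval (lift q r v)) (sval (lift p q u)).
  apply: (kernel_mono (ki r)); rewrite compmA !(proj2_sig (lift _ _ _)).
  by rewrite -compmA (proj2_sig (lift _ _ _)) fmor_comp compmA.
pose K := @Functor _ _ CP A _ (fun p q u => sval (lift p q u)) id_lift comp_lift.
by exists K, (@NatTrans _ _ CP A K M i (fun p q u => proj2_sig (lift p q u))).
Qed.

(** Dually, [fmor N u] descends to chosen objectwise cokernels, and cancelling the epis [q p] gives
    the functor laws. *)
Lemma exists_cokernel_functor {M N} (f : nat_trans M N) :
  abelian_category A ->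
  exists L (q : nat_trans N L), forall p, is_cokernel (f p) (q p).
Proof.
move=> hA.
have cp p : {c : obA & {q : mor A (N p) c | is_cokernel (f p) q}}.
  by case: (cid (has_cokernels hA (f p))) => c /cid[q cq]; exists c, q.
pose q p := sval (projT2 (cp p)).
have cq p : is_cokernel (f p) (q p) := proj2_sig (projT2 (cp p)).
have desc p r (u : mor CP p r) :
    {h | mcomp h (q p) = mcomp (q r) (fmor N u)}.
  apply/cid/(cokernel_desc (cq p)).
  by rewrite -compmA -naturality compmA (cq r).1 comp0m.
have id_desc p : sval (desc p p (mid CP p)) = mid A _.
  apply: (cokernel_epi (cq p)); rewrite (proj2_sig (desc _ _ _)).
  by rewrite fmor_id comp1m compm1.
have comp_desc p r s (v : mor CP r s) (u : mor CP p r) :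
    sval (desc p s (mcomp v u)) = mcomp (sval (desc r s v)) (sval (desc p r u)).
  apply: (cokernel_epi (cq p)); rewrite -compmA !(proj2_sig (desc _ _ _)).
  by rewrite compmA (proj2_sig (desc _ _ _)) fmor_comp compmA.
pose L := @Functor _ _ CP A _ (fun p r u => sval (desc p r u)) id_desc comp_desc.
by exists L, (@NatTrans _ _ CP A N L q (fun p r u => esym (proj2_sig (desc p r u)))).
Qed.

(** The universal property of [i] tests only against functors, not against single objects of [A]. So
    [i] is compared with an objectwise kernel [j], from which the property is transported at [p]. *)
Lemma is_kernel_component (hA : abelian_category A) {M N K}
    {f : mor (functor_category CP A) M N}
    {i : mor (functor_category CP A) K M} :
  is_kernel f i -> forall p, is_kernel (component f p) (component i p).
Proof.
move=> kf p; have [L [j kj]] := exists_kernel_functor f hA.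
have fj0 : @mcomp _ (functor_category CP A) _ _ _ f j = 0.
  by apply: nat_trans_ext => r; exact: (kj r).1.
have fi0 r : mcomp (component f r) (component i r) = 0.
  exact: (congr1 (fun g : nat_trans K N => g r) kf.1).
have [h ih] := kernel_lift kf _ _ fj0.
have lift r : {v | mcomp (j r) v = component i r}.
  exact/cid/(kernel_lift (kj r)).
have nat_lift r s (u : mor CP r s) :
    mcomp (sval (lift s)) (fmor K u) = mcomp (fmor L u) (sval (lift r)).
  apply: (kernel_mono (kj s)).
  rewrite !compmA (proj2_sig (lift s)) (naturality i).
  by rewrite (naturality j) -compmA (proj2_sig (lift r)).
pose v : mor (functor_category CP A) K L := @NatTrans _ _ CP A K L _ nat_lift.
(* Both [i h = j] and [j v = i] hold, so [i (h v) = i], and [i] cancels. *)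
have hv1 : mcomp h v = mid (functor_category CP A) K.
  apply: (kernel_mono kf); rewrite compmA ih compm1.
  by apply: nat_trans_ext => r; exact: (proj2_sig (lift r)).
have hvp : mcomp (component h p) (component v p) = mid A (K p).
  exact: (congr1 (fun g : nat_trans K K => g p) hv1).
have ihp : mcomp (component i p) (component h p) = j p.
  exact: (congr1 (fun g : nat_trans L M => g p) ih).
apply: is_kernel_of_mono => //.
  (* At [p], [i] is [j] after [v]: [j] is mono and [v] has the left inverse [h]. *)
  move=> t a b; rewrite -(proj2_sig (lift p)) -!compmA.
  move=> /(kernel_mono (kj p)) vab.
  by rewrite -[a](comp1m (c := A)) -[b](comp1m (c := A)) -hvp -!compmA vab.
move=> t g /(kernel_lift (kj p))[g' <-]; exists (mcomp (component h p) g').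
by rewrite compmA ihp.
Qed.

(** Dual comparison with an objectwise cokernel [j]: here [h q = j] and [v j = q], so [v h] is the
    identity. *)
Lemma is_cokernel_component (hA : abelian_category A) {M N L}
    {f : mor (functor_category CP A) M N}
    {q : mor (functor_category CP A) N L} :
  is_cokernel f q -> forall p, is_cokernel (component f p) (component q p).
Proof.
move=> cf p; have [K [j cj]] := exists_cokernel_functor f hA.
have jf0 : @mcomp _ (functor_category CP A) _ _ _ j f = 0.
  by apply: nat_trans_ext => r; exact: (cj r).1.
have qf0 r : mcomp (component q r) (component f r) = 0.
  exact: (congr1 (fun g : nat_trans M L => g r) cf.1).
have [h hq] := cokernel_desc cf _ _ jf0.
have desc r : {v | mcomp v (j r) = component q r}.
  exact/cid/(cokernel_desc (cj r)).
have nat_desc r s (u : mor CP r s) :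
    mcomp (sval (desc s)) (fmor K u) = mcomp (fmor L u) (sval (desc r)).
  apply: (cokernel_epi (cj r)).
  rewrite -!compmA (proj2_sig (desc r)) -(naturality q).
  by rewrite -(naturality j) compmA (proj2_sig (desc s)).
pose v : mor (functor_category CP A) K L := @NatTrans _ _ CP A K L _ nat_desc.
have vh1 : mcomp v h = mid (functor_category CP A) L.
  apply: (cokernel_epi cf); rewrite -compmA hq comp1m.
  by apply: nat_trans_ext => r; exact: (proj2_sig (desc r)).
have vhp : mcomp (component v p) (component h p) = mid A (L p).
  exact: (congr1 (fun g : nat_trans L L => g p) vh1).
have hqp : mcomp (component h p) (component q p) = j p.
  exact: (congr1 (fun g : nat_trans N K => g p) hq).
apply: is_cokernel_of_epi => //.
  move=> t a b; rewrite -(proj2_sig (desc p)) !compmA.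
  move=> /(cokernel_epi (cj p)) vab.
  by rewrite -[a](compm1 (c := A)) -[b](compm1 (c := A)) -vhp !compmA vab.
move=> t g /(cokernel_desc (cj p))[g' <-]; exists (mcomp g' (component h p)).
by rewrite -compmA hqp.
Qed.

Definition const_functor (z : obA) : functor CP A.
Proof.
by exists (fun=> z) (fun _ _ _ => mid A z) => // *; rewrite comp1m.
Defined.

End FunctorCategory.

(** * Weight bounds along steps and zigzags of persistence modules *)

Section IntegralWeight.
Local Open Scope ereal_scope.
Context {R : realType} {d : measure_display} {P : measurableType d}.
Context {mu : {measure set P -> \bar R}} {CP : category P}.
Context {obA : Type} {A : preadditive obA} (hA : abelian_category A).
Context {w : obA -> \bar R} (hw : exact_weight A w).
Implicit Types M N : functor CP A.

Let T := @integrable_module R d P mu CP obA A w.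
Let W := @integral_weight R d P mu CP obA A w.

(** The zero morphism has the identity of [M] as kernel and the identity of its target as cokernel;
    the latter contributes no cost since [w z = 0]. *)
Lemma step_to_zero {z : obA} (z0 : zero_object A z) M :
  mu.-integrable setT (fun p => w (M p)) ->
  step (functor_category CP A) T W M (const_functor z) (\int[mu]_p w (M p)).
Proof.
move=> iM; have wz : w z = 0 := weight_zero (exact_weight_weight hw) z0.
exists 0%R, M, (mid _ M), (const_functor z), (mid _ (const_functor z)).
split.
- apply: is_kernel_of_mono.
  + by move=> t g h; rewrite !comp1m.
  + by rewrite comp0m.
  + by move=> t g _; exists g; rewrite comp1m.
- apply: is_cokernel_of_epi.
  + by move=> t g h; rewrite !compm1.
  + by rewrite compm0.
  + by move=> t g _; exists g; rewrite compm1.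
- exact: iM.
- by rewrite /T /integrable_module/= wz; exact: integrable0.
- by rewrite /W /integral_weight/= wz integral0 adde0.
Qed.

(** Two additive inequalities replace [|w (M p) - w (N p)| <= g p]: they stay meaningful where both
    weights are infinite, and they chain along a zigzag. *)
Definition weight_close M N (c : \bar R) : Prop :=
  exists g : P -> \bar R, [/\ forall p, 0 <= g p, mu.-integrable setT g,
    \int[mu]_p g p = c &
    forall p, w (M p) <= w (N p) + g p /\ w (N p) <= w (M p) + g p].

Lemma weight_close_refl M : weight_close M M 0.
Proof.
exists (fun=> 0); split=> //; [exact: integrable0|exact: integral0|].
by move=> p; rewrite adde0.
Qed.

Lemma weight_close_sym {M N c} : weight_close M N c -> weight_close N M c.
Proof.
by move=> [g [g0 ig gc gMN]]; exists g; split=> // p; have [] := gMN p.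
Qed.

Lemma weight_close_trans {M L N c1 c2} :
  weight_close M L c1 -> weight_close L N c2 -> weight_close M N (c1 + c2).
Proof.
move=> [g [g0 ig <- gML]] [h [h0 ih <- hLN]].
exists (fun p => g p + h p); split.
- by move=> p; rewrite adde_ge0.
- exact: integrableD.
- rewrite ge0_integralD//; [exact: measurable_int ig|exact: measurable_int ih].
- move=> p; have [ML LM] := gML p; have [LN NL] := hLN p; split.
    by rewrite (le_trans ML)// (addeC (g p)) addeA leeD2r.
  by rewrite (le_trans NL)// addeA leeD2r.
Qed.

Lemma step_weight_close {M N c} :
  step (functor_category CP A) T W M N c -> weight_close M N c.
Proof.
move=> [f [K [i [L [q [ki cq iK iL ->]]]]]].
have w0 x : 0 <= w x := weight_ge0 (exact_weight_weight hw) x.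
exists (fun p => w (K p) + w (L p)); split.
- by move=> p; rewrite adde_ge0.
- exact: integrableD.
- rewrite ge0_integralD//; [exact: measurable_int iK|exact: measurable_int iL].
- move=> p; exact: (exact_weight_step hA hw (is_kernel_component hA ki p)
                                      (is_cokernel_component hA cq p)).
Qed.

Lemma zigzag_weight_close {M N c} :
  zigzag (functor_category CP A) T W M N c -> weight_close M N c.
Proof.
elim=> [|L K c1 c2 _ ML|L K c1 c2 _ ML].
- exact: weight_close_refl.
- by move=> /step_weight_close; exact: weight_close_trans.
- by move=> /step_weight_close/weight_close_sym; exact: weight_close_trans.
Qed.

End IntegralWeight.

Theorem theorem1p2 (R : realType) (d : measure_display) (P : measurableType d)
    (mu : {measure set P -> \bar R}) (CP : category P)
    (obA : Type) (A : preadditive obA) (hA : abelian_category A)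
    (w : obA -> \bar R) (hw : exact_weight A w)
    (M N : functor CP A)
    (hM : mu.-integrable setT (fun p => w (M p)))
    (hN : mu.-integrable setT (fun p => w (N p))) :
  (\int[mu]_p `|w (M p) - w (N p)| <= d_W mu w M N /\
   d_W mu w M N <= \int[mu]_p (w (M p) + w (N p)))%E.
Proof.
have w0 x : (0 <= w x)%E := weight_ge0 (exact_weight_weight hw) x.
split.
  apply/ereal_infP => c /(zigzag_weight_close hA hw)[g [g0 ig <- gMN]].
  have iD : mu.-integrable setT (fun p => w (M p) - w (N p))%E.
    exact: integrableB.
  apply: ae_ge0_le_integral => //.
  - exact: measurable_int (integrable_abse iD).
  - exact: measurable_int ig.
  (* Where both weights are [+oo], their formal difference is [-oo], of absolute value [+oo], and
     the bound by [g] could fail. Integrability confines this to a null set. *)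
  - have := integrable_ae measurableT hM; have := integrable_ae measurableT hN.
    apply: filterS2 => p /(_ Logic.I) fN /(_ Logic.I) fM _.
    move: fM fN (gMN p).
    (* With finite weights only [g p] can be infinite: [+oo] bounds everything, and [-oo]
       contradicts the inequalities. *)
    case: (w (M p)) (w (N p)) (g p) => [x||] [y||] [e||]//= _ _;
      [|by rewrite !leey|by case].
    by rewrite !lee_fin ler_distl lerBlDr => -[-> ->].
have [z z0] := has_zero_object hA.
(* Once split into two integrals, the right-hand side is the cost of one explicit zigzag, up to the
   initial [0] of the empty one. *)
apply: ereal_inf_lbound; rewrite ge0_integralD//;
  [|exact: measurable_int hM|exact: measurable_int hN].
have MZ := zigzag_forward (zigzag_nil _ _ _ M) (step_to_zero hw z0 _ hM).
by have := zigzag_backward MZ (step_to_zero hw z0 _ hN); rewrite add0e.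
Qed.
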